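(* For each $n\ge1$, let $\boldsymbol{G}_n$ be a uniform random unlabeled permutation graph with $n$ vertices (all $\boldsymbol{G}_n$ being defined on a common probability space). Then for all $k\ge1$, as $n\to+\infty$, $$\frac{\#\{\text{cliques of size }k\text{ in }\boldsymbol{G}_n\}}{\binom nk}\longrightarrow\frac1{k!}\quad\text{almost surely.}$$ In particular, $\#\{\text{edges of }\boldsymbol{G}_n\}/\binom n2\to\frac12$ and $\#\{\text{triangles of }\boldsymbol{G}_n\}/\binom n3\to\frac16$ almost surely.
   Context: For a permutation $\sigma$ of $\{1,\dots,n\}$, the inversion graph $G_\sigma$ is the unlabeled version of the graph on vertex set $\{1,\dots,n\}$ in which $i\neq j$ are adjacent if and only if $(\sigma(i)-\sigma(j))(i-j)<0$. A permutation graph is an unlabeled graph (graph up to isomorphism) equal to $G_\sigma$ for some permutation $\sigma$. Uniform means uniform over the finite set of unlabeled permutation graphs with $n$ vertices. A clique of size $k$ is a set of $k$ pairwise adjacent vertices. *)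

(* Defs.v *)
From HB Require Import structures.
From mathcomp Require Import all_boot all_order all_algebra all_fingroup.
From mathcomp Require Import all_classical all_reals all_analysis.
From mathcomp Require Import generic_quotient.

Set Implicit Arguments.
Unset Strict Implicit.
Unset Printing Implicit Defensive.

Import Order.TTheory GRing.Theory Num.Theory.
Import numFieldNormedType.Exports.

Local Open Scope classical_set_scope.
Local Open Scope quotient_scope.
Local Open Scope ring_scope.

(* Simple graphs on the vertices 0, ..., n-1 (rather than 1, ..., n); each edge
   {i, j} is stored as the two ordered pairs (i, j) and (j, i). *)
Record sgraph (n : nat) := SGraph {
  arcs : {set 'I_n * 'I_n};
  _ : [forall i, (i, i) \notin arcs] &&
      [forall i, forall j, ((i, j) \in arcs) == ((j, i) \in arcs)] }.

HB.instance Definition _ n := [isSub for @arcs n].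
HB.instance Definition _ n := [Finite of sgraph n by <:].

Definition adj (n : nat) (g : sgraph n) : rel 'I_n :=
  fun i j => (i, j) \in arcs g.

Definition isomorphic (n : nat) : rel (sgraph n) := fun g h =>
  [exists s : 'S_n, [forall i, forall j, adj g i j == adj h (s i) (s j)]].

Lemma isomorphicP (n : nat) (g h : sgraph n) :
  reflect (exists s : 'S_n, forall i j, adj g i j = adj h (s i) (s j))
          (isomorphic g h).
Proof.
apply: (iffP existsP) => -[s H]; exists s.
  by move=> i j; move/forallP/(_ i)/forallP/(_ j)/eqP: H.
by apply/forallP => i; apply/forallP => j; rewrite H.
Qed.

Lemma isomorphic_refl n : reflexive (@isomorphic n).
Proof. by move=> g; apply/isomorphicP; exists 1%g => i j; rewrite !perm1. Qed.

Lemma isomorphic_sym n : symmetric (@isomorphic n).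
Proof.
suff sym g h : @isomorphic n g h -> isomorphic h g.
  by move=> g h; apply/idP/idP; exact: sym.
move/isomorphicP => -[s H]; apply/isomorphicP; exists s^-1%g => i j.
by rewrite H !permKV.
Qed.

Lemma isomorphic_trans n : transitive (@isomorphic n).
Proof.
move=> h g k /isomorphicP[s Hs] /isomorphicP[t Ht].
by apply/isomorphicP; exists (s * t)%g => i j; rewrite Hs Ht !permM.
Qed.

Canonical isomorphic_equiv n :=
  EquivRel (@isomorphic n) (@isomorphic_refl n) (@isomorphic_sym n)
           (@isomorphic_trans n).

Definition ugraph (n : nat) := {eq_quot (@isomorphic n)}.

HB.instance Definition _ n := Choice.on (ugraph n).
HB.instance Definition _ n := EqQuotient.on (ugraph n).
HB.instance Definition _ n :=
  Countable.copy (ugraph n) (can_type (@reprK _ (ugraph n))).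
(* fintype.isFinite is qualified: measure theory has its own isFinite. *)
HB.instance Definition _ n :=
  fintype.isFinite.Build (ugraph n)
    (pcan_enumP (can_pcan (@reprK (sgraph n) (ugraph n)))).

(* The subtractions are in int; the condition already forces i != j and is
   unaffected by the shift of the vertices and values by 1. *)
Definition inv_adj (n : nat) (s : 'S_n) : rel 'I_n := fun i j =>
  ((s i)%:Z - (s j)%:Z) * (i%:Z - j%:Z) < 0.

Lemma inv_arcs_subproof (n : nat) (s : 'S_n) :
  let A := [set p : 'I_n * 'I_n | inv_adj s p.1 p.2]%SET in
  [forall i, (i, i) \notin A] &&
  [forall i, forall j, ((i, j) \in A) == ((j, i) \in A)].
Proof.
apply/andP; split; apply/forallP => i; first by rewrite inE /inv_adj !subrr.
apply/forallP => j; rewrite !inE /inv_adj /=.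
by rewrite -mulrNN !opprB.
Qed.

Definition inv_graph (n : nat) (s : 'S_n) : sgraph n :=
  SGraph (inv_arcs_subproof s).

Definition perm_ugraphs (n : nat) : {set ugraph n} :=
  [set \pi_(ugraph n) (inv_graph s) | s : 'S_n]%SET.

Definition cliques (n k : nat) (g : sgraph n) : {set {set 'I_n}} :=
  [set A : {set 'I_n} | (#|A| == k) &&
     [forall i in A, forall j in A, (i != j) ==> adj g i j]]%SET.

Definition edges (n : nat) (g : sgraph n) : {set {set 'I_n}} :=
  [set A : {set 'I_n} | [exists i, exists j,
     adj g i j && (A == [set i; j]%SET)]]%SET.

Definition triangles (n : nat) (g : sgraph n) : {set {set 'I_n}} :=
  [set A : {set 'I_n} | [exists i, exists j, exists l,
     [&& adj g i j, adj g j l, adj g i l & A == [set i; j; l]%SET]]]%SET.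

(* The numbers of cliques, edges and triangles of an unlabeled graph are read
   off an arbitrary representative; see num_cliques_pi, num_edges_pi and
   num_triangles_pi for independence of this choice. *)
Definition num_cliques (n k : nat) (G : ugraph n) : nat :=
  #|cliques k (repr G)|.
Definition num_edges (n : nat) (G : ugraph n) : nat := #|edges (repr G)|.
Definition num_triangles (n : nat) (G : ugraph n) : nat :=
  #|triangles (repr G)|.

Lemma card_iso_invariant (n : nat) (F : sgraph n -> {set {set 'I_n}}) :
  (forall (g h : sgraph n) (s : 'S_n),
     (forall i j, adj g i j = adj h (s i) (s j)) ->
     forall A : {set 'I_n}, A \in F g -> (s @: A)%SET \in F h) ->
  forall g h : sgraph n, isomorphic g h -> #|F g| = #|F h|.
Proof.
move=> HF; suff le g h : isomorphic g h -> (#|F g| <= #|F h|)%N.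
  move=> g h gh; apply/eqP; rewrite eqn_leq !le //.
  by rewrite isomorphic_sym.
move=> /isomorphicP[s Hs].
rewrite -(card_imset (mem (F g)) (imset_inj (@perm_inj _ s))).
apply: subset_leq_card; apply/fintype.subsetP => _ /imsetP[A AF ->].
exact: HF Hs A AF.
Qed.

Lemma repr_pi_iso (n : nat) (g : sgraph n) :
  isomorphic (repr (\pi_(ugraph n) g)) g.
Proof. by apply/eqmodP; rewrite reprK. Qed.

Lemma num_cliques_pi (n k : nat) (g : sgraph n) :
  num_cliques k (\pi_(ugraph n) g) = #|cliques k g|.
Proof.
apply: (card_iso_invariant (F := cliques k)) (repr_pi_iso g).
move=> {}g h s Hs A; rewrite !inE => /andP[/eqP cA /forallP HA].
rewrite card_imset ?cA ?eqxx /=; last exact: perm_inj.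
apply/forall_inP => _ /imsetP[i iA ->]; apply/forall_inP => _ /imsetP[j jA ->].
rewrite (inj_eq perm_inj) -Hs.
by move: (HA i); rewrite iA /= => /forall_inP/(_ j jA).
Qed.

Lemma num_edges_pi (n : nat) (g : sgraph n) :
  num_edges (\pi_(ugraph n) g) = #|edges g|.
Proof.
apply: (card_iso_invariant (F := @edges n)) (repr_pi_iso g).
move=> {}g h s Hs A; rewrite !inE => /existsP[i /existsP[j /andP[ij /eqP->]]].
apply/existsP; exists (s i); apply/existsP; exists (s j).
by rewrite -Hs ij imsetU !imset_set1 eqxx.
Qed.

Lemma num_triangles_pi (n : nat) (g : sgraph n) :
  num_triangles (\pi_(ugraph n) g) = #|triangles g|.
Proof.
apply: (card_iso_invariant (F := @triangles n)) (repr_pi_iso g).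
move=> {}g h s Hs A; rewrite !inE => /existsP[i /existsP[j /existsP[l]]].
move=> /and4P[ij jl il /eqP->].
apply/existsP; exists (s i); apply/existsP; exists (s j).
apply/existsP; exists (s l).
by rewrite -!Hs ij jl il !imsetU !imset_set1 eqxx.
Qed.

(* Y is a random element of X, with X given the discrete sigma-algebra, whose
   law is uniform on A. *)
Definition uniform_on (d : measure_display) (T : measurableType d)
    (R : realType) (P : probability T R) (X : finType) (A : {set X})
    (Y : T -> X) : Prop :=
  (forall B : set X, measurable (Y @^-1` B)) /\
  (forall x : X, P (Y @^-1` [set x]) =
                 (if x \in A then (#|A|%:R^-1 : R) else 0)%:E).

(* Main.v *)
Require Import Defs.
From mathcomp Require Import all_boot all_order all_algebra all_fingroup.
From mathcomp Require Import all_classical all_reals all_analysis.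
From mathcomp Require Import generic_quotient zify lra ring.

Set Implicit Arguments.
Unset Strict Implicit.
Unset Printing Implicit Defensive.

Import Order.TTheory GRing.Theory Num.Theory.
Import numFieldNormedType.Exports.

(** Two estimates carry the proof.

    Counting.  Up to a factor exp(o(n)) there are as many unlabeled permutation
    graphs as permutations ([fact_le_expR_perm_ugraphs]).  Hence an event whose
    probability is exponentially small for a uniform permutation is still
    exponentially small for a uniform unlabeled permutation graph.  For the
    lower bound on the number of graphs, fix the values of a permutation s on
    a small set of points, the frame.  The first k positions carry values that
    cut the remaining values into short blocks, and the lowest k values sit at
    positions that cut the remaining positions into short blocks.  In the graph
    of s, the adjacency of a vertex to the frame tells in which block its
    position lies and in which block its value lies.  Two vertices whose
    position blocks differ have positions in a known order.  If the position
    blocks agree but the value blocks differ, then the order of the values is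
    known and adjacency gives the order of the positions.  So s is determined by
    its unlabeled graph once the frame points and the crowded points, those
    sharing both blocks with another point, are located in the graph
    ([framed_rigid]).  A framed permutation has few crowded points on average,
    so by Markov's inequality at least half of the framed permutations are
    encoded by their unlabeled graph together with few labels
    ([fact_le_perm_ugraphs]).

    Concentration.  The cliques of the inversion graph of s are the sets on
    which s is decreasing, so the clique density of a uniform permutation is a
    U-statistic.  Following Hoeffding, it is the average, over all
    permutations p of the positions, of the proportion of consecutive blocks of
    length k whose image under p is a set on which s is decreasing
    ([clique_density_blocks]).  For a fixed p these events are independent with
    probability 1/k! ([sum_prod_decreasing]), so Jensen's inequality for exp
    bounds the moment generating function of the density by that of a binomial
    proportion, and Chernoff's bound gives exponential concentration around
    1/k! ([clique_density_tail]).

    The deviation probabilities of the random graphs are therefore summable,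
    and the Borel-Cantelli lemma gives almost sure convergence.  Edges and
    triangles are the cliques of size 2 and 3. *)

Local Open Scope quotient_scope.
Local Open Scope nat_scope.

(** * Inversion graphs determine permutations *)

Lemma inv_adj_sym n (s : 'S_n) i j : inv_adj s i j = inv_adj s j i.
Proof. by rewrite /inv_adj -mulrNN !opprB. Qed.

Lemma inv_adj_lt n (s : 'S_n) (i j : 'I_n) :
  i < j -> inv_adj s i j = (s j < s i).
Proof.
move=> ij; rewrite /inv_adj nmulr_llt0 ?subr_gt0 ?ltz_nat //.
by rewrite subr_lt0 ltz_nat.
Qed.

(** Look at the least point r moved by s: every smaller point is fixed, so r has
    to go up and its preimage lies above it, against monotonicity. *)
Lemma increasing_perm1 n (A : {set 'I_n}) (s : 'S_n) :
  perm_on A s -> {in A &, {homo s : i j / i < j}} -> s = 1%g.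
Proof.
move=> sA incr; apply/permP => i; rewrite perm1; apply/eqP/negP => /negP ne.
have [r rP rmin] := @arg_minnP _ i (fun j => s j != j) (@nat_of_ord n) ne.
have low (j : 'I_n) : j < r -> s j = j.
  by move=> jr; apply/eqP; apply: contraLR jr => /rmin; rewrite -leqNgt.
have rA : r \in A by apply: contraNT rP => /(out_perm sA)/eqP.
case: (ltngtP (s r) r) => [lt|gt|/val_inj e]; last by rewrite e eqxx in rP.
  by move: (low _ lt) => /perm_inj e; rewrite e ltnn in lt.
have := permKV s r; set q := (s^-1)%g r => sq.
have qA : q \in A by rewrite -(perm_closed _ sA) sq.
case: (ltngtP q r) => [lt|lt|/val_inj e].
- by rewrite (low _ lt) in sq; rewrite sq ltnn in lt.
- by move: (incr _ _ rA qA lt); rewrite sq ltnNge (ltnW gt).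
- by rewrite -e sq e ltnn in gt.
Qed.

Lemma increasing_perm_id n (s : 'S_n) : {homo s : i j / i < j} -> s = 1%g.
Proof.
move=> incr; apply: (@increasing_perm1 _ [set: 'I_n]%SET).
  by apply/fintype.subsetP => i _; rewrite inE.
by move=> i j _ _; apply: incr.
Qed.

(** The adjacency of i and j compares the values of s at i and j, so if s and t
    have the same inversions then t after the inverse of s is increasing. *)
Lemma inv_adj_inj n (s t : 'S_n) : inv_adj s =2 inv_adj t -> s = t.
Proof.
move=> st; suff /increasing_perm_id e : {homo (s^-1 * t)%g : i j / i < j}.
  by rewrite -[t]mul1g -(mulgV s) -mulgA e mulg1.
move=> i j; rewrite !permM -{1}[i](permKV s) -{1}[j](permKV s).
move: ((s^-1)%g i) ((s^-1)%g j) => {i j} i j ij.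
case: (ltngtP i j) => [lt|lt|/val_inj e]; last by rewrite e ltnn in ij.
- have := st i j; rewrite !inv_adj_lt // ltnNge (ltnW ij) /=.
  move/esym/negbT; rewrite -leqNgt leq_eqVlt => /orP[/eqP/val_inj/perm_inj|//].
  by move=> e; rewrite e ltnn in lt.
- by have := st j i; rewrite !inv_adj_lt // ij => /esym.
Qed.

(** * The frame and the rigidity of framed permutations *)

Section Frame.
Variables (n m : nat).
Let k := n %/ m.+1.

(** With 0-based indices, the cut points k, k + m, k + 2m, ... serve both for
    positions and for values. *)
Definition separator (j : nat) : nat := k + j * m.

(** This involution exchanges j with [separator j] for each j < k: the first k
    positions carry the separating values, and the k lowest values sit at the
    separating positions. *)
Definition frame_fun (i : nat) : nat :=
  if i < k then separator i
  else if (m %| i - k) && ((i - k) %/ m < k) then (i - k) %/ m else i.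

Definition framed_points : {set 'I_n} :=
  [set i : 'I_n | (i < k) || [exists j : 'I_k, i == separator j :> nat]].

(** No cut point falls between x and y. *)
Definition coblock (x y : nat) : bool :=
  [forall j : 'I_k, (x < separator j) == (y < separator j)].

Lemma coblock_sym x y : coblock x y = coblock y x.
Proof. by apply: eq_forallb => j; rewrite eq_sym. Qed.

Hypothesis m_gt0 : 0 < m.

Lemma separator_lt j : j < k -> separator j < n.
Proof.
rewrite /separator => jk; have := leq_divM n m.+1; rewrite -/k mulnS => kn.
have : j.+1 * m <= k * m by rewrite leq_mul2r jk orbT.
rewrite mulSn; lia.
Qed.

Lemma frame_fun_separator j : j < k -> frame_fun (separator j) = j.
Proof.
move=> jk; rewrite /frame_fun /separator ltnNge leq_addr /= addKn.
by rewrite dvdn_mull // mulnK // jk.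
Qed.

Lemma frame_fun_lt i : i < n -> frame_fun i < n.
Proof.
rewrite /frame_fun; case: ifP => [/separator_lt //|_].
case: ifP => [/andP[_]|//]; have := leq_div n m.+1; rewrite -/k; lia.
Qed.

Lemma frame_funK : involutive frame_fun.
Proof.
move=> i; have [ik|ki] := ltnP i k.
  by rewrite {2}/frame_fun ik frame_fun_separator.
rewrite {2}/frame_fun ltnNge ki /=; case: ifP => [/andP[mi ilt]|ni].
  by rewrite /frame_fun ilt /separator divnK // subnKC.
by rewrite /frame_fun ltnNge ki /= ni.
Qed.

Definition frame_ord (i : 'I_n) : 'I_n := Ordinal (frame_fun_lt (ltn_ord i)).

Lemma frame_ord_inj : injective frame_ord.
Proof.
move=> i j /(congr1 val)/= e; apply: val_inj.
by rewrite /= -(frame_funK i) e frame_funK.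
Qed.

Definition frame : 'S_n := perm frame_ord_inj.

Lemma val_frame i : frame i = frame_fun i :> nat.
Proof. by rewrite permE. Qed.

Definition framed_perms : {set 'S_n} :=
  [set s : 'S_n | [forall i in framed_points, s i == frame i]].

Lemma framed_permsP (s : 'S_n) (i : 'I_n) :
  s \in framed_perms -> i \in framed_points -> s i = frame i.
Proof. by rewrite inE => /forall_inP H /H /eqP. Qed.

Lemma low_framed (i : 'I_n) : i < k -> i \in framed_points.
Proof. by rewrite inE => ->. Qed.

Lemma separator_framed (i : 'I_n) j :
  j < k -> i = separator j :> nat -> i \in framed_points.
Proof.
move=> jk e; rewrite inE; apply/orP; right; apply/existsP.
by exists (Ordinal jk); rewrite e.
Qed.

Lemma unframed_ge (v : 'I_n) : v \notin framed_points -> k <= v.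
Proof. by apply: contraR; rewrite -ltnNge => /low_framed. Qed.

Lemma unframed_val_ge (s : 'S_n) (v : 'I_n) :
  s \in framed_perms -> v \notin framed_points -> k <= s v.
Proof.
move=> sF; apply: contraR; rewrite -ltnNge => lt.
have c : separator (s v) < n by apply: separator_lt.
have cD : Ordinal c \in framed_points by apply: (separator_framed lt).
suff -> : v = Ordinal c by [].
apply: (@perm_inj _ s); rewrite [RHS](framed_permsP sF cD).
by apply: val_inj; rewrite /= val_frame frame_fun_separator.
Qed.

Definition crowded (s : 'S_n) : {set 'I_n} :=
  [set v | (v \notin framed_points) && [exists w : 'I_n,
     [&& w != v, w \notin framed_points, coblock v w & coblock (s v) (s w)]]].

Section Rigid.
Variables s t : 'S_n.
Hypotheses (sF : s \in framed_perms) (tF : t \in framed_perms).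
Variable phi : 'S_n.
Hypothesis iso : forall i j, inv_adj s i j = inv_adj t (phi i) (phi j).
Hypothesis fixed : {in framed_points, forall i, phi i = i}.

Lemma iso_unframed v : v \notin framed_points -> phi v \notin framed_points.
Proof.
by apply: contra => vD; rewrite -(perm_inj (fixed vD)).
Qed.

(** The frame point at position [separator j] has a value below that of every
    point outside the frame, so it is adjacent to exactly those of them that lie
    to its left. *)
Lemma iso_position v j : v \notin framed_points -> j < k ->
  (phi v < separator j) = (v < separator j).
Proof.
move=> vD jk; have c := separator_lt jk; pose C := Ordinal c.
have CD : C \in framed_points by apply: (separator_framed jk).
have adj_sep (r : 'S_n) u : r \in framed_perms -> u \notin framed_points ->
    inv_adj r u C = (u < separator j).
  move=> rF uD; have := unframed_val_ge rF uD => ku.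
  have rC : r C = j :> nat.
    by rewrite (framed_permsP rF CD) val_frame frame_fun_separator.
  case: (ltngtP u (separator j)) => [lt|lt|e].
  - by rewrite inv_adj_lt // rC (leq_trans jk).
  - by rewrite inv_adj_sym inv_adj_lt // rC ltnNge ltnW // (leq_trans jk).
  - by move: uD; rewrite (_ : u = C) ?CD //; apply: val_inj.
by rewrite -(adj_sep t) ?iso_unframed // -(adj_sep s) // iso (fixed CD).
Qed.

(** The frame point at position j < k lies to the left of every point outside
    the frame, so it is adjacent to exactly those of them with values below
    [separator j]. *)
Lemma iso_value v j : v \notin framed_points -> j < k ->
  (t (phi v) < separator j) = (s v < separator j).
Proof.
move=> vD jk; have jn : j < n by apply: leq_trans jk (leq_div _ _).
pose b := Ordinal jn; have bD : b \in framed_points by apply: low_framed.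
have adj_low (r : 'S_n) u : r \in framed_perms -> u \notin framed_points ->
    inv_adj r b u = (r u < separator j).
  move=> rF uD; rewrite inv_adj_lt; last by apply: leq_trans (unframed_ge uD).
  by rewrite (framed_permsP rF bD) val_frame /frame_fun /= jk.
by rewrite -(adj_low t) ?iso_unframed // -(adj_low s) // iso (fixed bD).
Qed.

(** It is enough that [phi] is increasing, hence the identity.  The order of
    the positions of v and w is recovered from a separating position between
    them, or else from adjacency and a separating value between their values;
    if there is neither, both are crowded and fixed by [phi]. *)
Lemma framed_rigid : {in crowded s, forall i, phi i = i} -> s = t.
Proof.
move=> fixed_crowded; suff phi1 : phi = 1%g.
  by apply: inv_adj_inj => i j; rewrite iso phi1 !perm1.
apply: increasing_perm_id => v w vw.
(* A frame point lies either before all points outside the frame or at a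
   separating position, so iso_position also orders it against them. *)
have [vD|vD] := boolP (v \in framed_points); last first.
  have [wD|wD] := boolP (w \in framed_points).
    rewrite (fixed wD); move: wD; rewrite inE => /orP[wk|/existsP[j /eqP e]].
      by move: (unframed_ge vD); rewrite leqNgt (ltn_trans vw).
    by rewrite e iso_position // -e.
  have [|/forallPn[j]] := boolP (coblock v w); last first.
    case: (ltnP v (separator j)) => hv; case: (ltnP w (separator j)) => hw //.
      move=> _; apply: (@leq_trans (separator j)); first by rewrite iso_position.
      by rewrite leqNgt iso_position // -leqNgt.
    by have := leq_trans hw hv; rewrite leqNgt (leq_trans vw).
  move=> cb; have [cbs|/forallPn[j]] := boolP (coblock (s v) (s w)).
    have nevw : w != v by apply: contraTneq vw => ->; rewrite ltnn.
    have vB : v \in crowded s.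
      by rewrite inE vD; apply/existsP; exists w; rewrite nevw wD cb.
    have wB : w \in crowded s.
      rewrite inE wD; apply/existsP; exists v; rewrite eq_sym nevw vD /=.
      by rewrite coblock_sym cb coblock_sym.
    by rewrite !fixed_crowded.
  have := iso v w; rewrite (inv_adj_lt _ vw) -(iso_value vD (ltn_ord j)).
  rewrite -(iso_value wD (ltn_ord j)) => adj_vw sep.
  have orders : (t (phi v) < t (phi w)) = (s v < s w).
    move: (iso_value vD (ltn_ord j)) (iso_value wD (ltn_ord j)) sep.
    lia.
  case: (ltngtP (phi v) (phi w)) => // [lt|/val_inj/perm_inj e].
    have neq : t (phi v) != t (phi w) :> nat.
      by apply: contraTneq lt => /val_inj/perm_inj ->; rewrite ltnn.
    have neqs : s v != s w :> nat.
      by apply: contraTneq vw => /val_inj/perm_inj ->; rewrite ltnn.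
    move: adj_vw; rewrite inv_adj_sym inv_adj_lt //.
    move: neq neqs orders; lia.
  by rewrite e ltnn in vw.
have [wD|wD] := boolP (w \in framed_points); first by rewrite !fixed.
rewrite (fixed vD); have := vD; rewrite inE => /orP[vk|/existsP[j /eqP e]].
  by apply: leq_trans (unframed_ge (iso_unframed wD)).
rewrite ltn_neqAle; apply/andP; split.
  by apply: contraTneq vw => /val_inj ew; rewrite -{1}(fixed vD) in ew;
    rewrite (perm_inj ew) ltnn.
by rewrite leqNgt e iso_position // -e -leqNgt ltnW.
Qed.

End Rigid.
End Frame.

(** * Counting framed permutations by unlabeled graphs *)

(** These permutations form the right coset, by [s0], of the permutations
    supported outside D. *)
Lemma card_perm_agree n (s0 : 'S_n) (D : {set 'I_n}) :
  #|[set s : 'S_n | [forall i in D, s i == s0 i]]| = (n - #|D|)`!.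
Proof.
have -> : [set s : 'S_n | [forall i in D, s i == s0 i]] =
    [set (t * s0)%g | t in perm_on (~: D)].
  apply/setP => s; rewrite inE; apply/forall_inP/imsetP => [agree|[t tD ->] i iD].
    exists (s * s0^-1)%g; last by rewrite mulgKV.
    apply/fintype.subsetP => i; rewrite !inE; apply: contra => /agree/eqP e.
    by rewrite permM e permK.
  by rewrite permM (out_perm tD) // inE iD.
rewrite card_imset; last exact: mulIg.
by rewrite card_perm -[X in (X - _)`!]card_ord -(cardsC D) addKn.
Qed.

Lemma card_perm_agree_le n (f : 'I_n -> 'I_n) (D : {set 'I_n}) :
  #|[set s : 'S_n | [forall i in D, s i == f i]]| <= (n - #|D|)`!.
Proof.
case: (set_0Vmem [set s : 'S_n | [forall i in D, s i == f i]]) => [->|[s0]].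
  by rewrite cards0.
rewrite inE => /forall_inP s0f; rewrite -(card_perm_agree s0 D).
apply: subset_leq_card; apply/fintype.subsetP => s; rewrite !inE => /forall_inP sf.
by apply/forall_inP => i iD; rewrite (eqP (sf i iD)) (eqP (s0f i iD)).
Qed.

(** A chosen isomorphism from the inversion graph of s to the representative of
    its class, so that two permutations with isomorphic graphs are labelled by
    the same vertices. *)
Definition canonical_iso n (s : 'S_n) : 'S_n :=
  odflt 1%g [pick phi : 'S_n | [forall i, forall j, inv_adj s i j ==
    adj (repr (\pi_(ugraph n) (inv_graph s))) (phi i) (phi j)]].

Lemma canonical_isoP n (s : 'S_n) i j : inv_adj s i j =
  adj (repr (\pi_(ugraph n) (inv_graph s))) (canonical_iso s i)
    (canonical_iso s j).
Proof.
rewrite /canonical_iso; case: pickP => [phi /forallP/(_ i)/forallP/(_ j)/eqP //|].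
have := repr_pi_iso (inv_graph s); rewrite isomorphic_sym => /isomorphicP[phi H].
move/(_ phi)/negP; case; apply/forallP => u; apply/forallP => v.
by rewrite -H /adj inE.
Qed.

(** Such a permutation is encoded by its unlabeled graph and by K pairs listing
    the frame points and the crowded points with their images in the
    representative graph.  If two permutations have the same code, their
    canonical isomorphisms agree on these points, and [framed_rigid] applies to
    the isomorphism that they induce. *)
Lemma card_uncrowded_framed_le n m (m_gt0 : 0 < m) M K : 0 < n ->
  #|framed_points n m| + M <= K ->
  #|[set s in framed_perms n m_gt0 | #|crowded m s| <= M]|
    <= #|perm_ugraphs n| * (n * n) ^ K.
Proof.
case: n => // n' _; set n := n'.+1 => leK; set D := framed_points n m.
set S := [set s in _ | _].
pose vertices (s : 'S_n) := enum (D :|: crowded m s).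
(* Every entry of the code is a pair (i, canonical_iso s i), also where the
   default ord0 pads the list, so an entry shared by two codes always gives a
   point at which the two isomorphisms agree. *)
pose code (s : 'S_n) := (\pi_(ugraph n) (inv_graph s), [ffun r : 'I_K =>
  let i := nth ord0 (vertices s) r in (i, canonical_iso s i)]).
have code_inj : {in S &, injective code}.
  have SP s : s \in S -> s \in framed_perms n m_gt0 /\ #|crowded m s| <= M.
    by rewrite finset.in_set => /andP[].
  move=> s t /SP[sF sM] /SP[tF tM] [eg ec].
  have agree : {in D :|: crowded m s, forall i,
      canonical_iso s i = canonical_iso t i}.
    move=> i iD; have isz : index i (vertices s) < size (vertices s).
      by rewrite index_mem mem_enum.
    have iK : index i (vertices s) < K.
      apply: leq_trans isz _; rewrite -cardE.
      apply: leq_trans (leq_card_setU _ _) (leq_trans _ leK).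
      by rewrite leq_add2l.
    move/ffunP/(_ (Ordinal iK)): ec; rewrite !ffunE /=.
    by rewrite nth_index ?mem_enum // => -[<-].
  pose phi := (canonical_iso s * (canonical_iso t)^-1)%g.
  have fix_phi i : i \in D :|: crowded m s -> phi i = i.
    by move=> /agree e; rewrite permM e permK.
  apply: (framed_rigid sF tF (phi := phi)).
  - move=> i j; rewrite !permM canonical_isoP [RHS]canonical_isoP !permKV.
    by rewrite eg.
  - by move=> i iD; apply: fix_phi; rewrite inE iD.
  - by move=> i iD; apply: fix_phi; rewrite inE iD orbT.
rewrite -(card_in_imset code_inj).
apply: (@leq_trans #|finset.setX (perm_ugraphs n)
    [set: {ffun 'I_K -> 'I_n * 'I_n}]%SET|).
  apply: subset_leq_card; apply/fintype.subsetP => _ /imsetP[s _ ->].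
  by rewrite !inE andbT; apply: imset_f.
by rewrite cardsX cardsT card_ffun card_prod !card_ord.
Qed.

Section Crowded.
Variables (n m : nat).
Hypothesis m_gt0 : 0 < m.
Let k := n %/ m.+1.
Let D := framed_points n m.

Lemma card_framed_points : #|D| <= 2 * k.
Proof.
case: (set_0Vmem D) => [->|[i0 _]]; first by rewrite cards0.
pose h (p : bool * 'I_k) : 'I_n :=
  insubd i0 (if p.1 then nat_of_ord p.2 else separator n m p.2).
apply: (@leq_trans #|[set h p | p in [set: bool * 'I_k]%SET]|); last first.
  rewrite (leq_trans (leq_imset_card _ _)) // cardsT.
  by rewrite card_prod card_bool card_ord.
apply: subset_leq_card; apply/fintype.subsetP => i.
rewrite inE => /orP[ik|/existsP[j /eqP e]]; apply/imsetP.
  exists (true, Ordinal ik); rewrite ?inE //.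
  by apply: val_inj; rewrite val_insubd /= ltn_ord.
exists (false, j); rewrite ?inE //.
by apply: val_inj; rewrite val_insubd /= -e ltn_ord.
Qed.

(** Blocks have length m, except the last one: it stops at n, which is less than
    (k + 1) (m + 1), so its length is at most 2m. *)
Lemma coblock_close x y : k <= x -> x <= y -> y < n -> coblock n m x y ->
  y <= x + 2 * m.
Proof.
move=> kx xy yn /forallP cb.
have kn : n < k.+1 * m.+1 by rewrite ltn_ceil.
have xlo := leq_divM (x - k) m; have xhi := ltn_ceil (x - k) m_gt0.
move: ((x - k) %/ m) xlo xhi => j xlo xhi.
have [jk|kj] := ltnP j.+1 k.
  have := cb (Ordinal jk); rewrite /separator -/k /=.
  have -> : x < k + j.+1 * m by lia.
  rewrite eq_sym eqb_id mulSn; lia.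
have : k.-1 * m <= j * m by rewrite leq_mul2r; lia.
move: kn xlo; case: (k) kx kj => [|k'] /=; rewrite !mulSn ?mulnS; lia.
Qed.

Lemma card_coblock (x : 'I_n) : k <= x ->
  #|[set y : 'I_n | (k <= y) && coblock n m x y]| <= 4 * m + 1.
Proof.
move=> kx; rewrite addn1.
(* Points in the block of x differ from x by at most 2m on either side. *)
pose h (y : 'I_n) : 'I_(4 * m).+1 := inord (y + 2 * m - x).
have h_lt (y : 'I_n) : k <= y -> coblock n m x y ->
    x <= y + 2 * m /\ y + 2 * m - x < (4 * m).+1.
  move=> ky cb; case: (leqP x y) => [xy|/ltnW yx].
    have := coblock_close kx xy (ltn_ord y) cb; lia.
  rewrite coblock_sym in cb.
  have := coblock_close ky yx (ltn_ord x) cb; lia.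
rewrite -[X in _ <= X]card_ord -(card_in_imset (f := h)) ?max_card //.
move=> y z; rewrite !inE => /andP[/h_lt yl /yl[y1 y2]] /andP[/h_lt zl /zl[z1 z2]].
move/(congr1 val); rewrite /= !inordK // => e.
by apply: val_inj => /=; lia.
Qed.

Lemma sum_coblock (S : rel 'I_n) (c : nat) :
  (forall v w, S v w -> [&& k <= v, k <= w & coblock n m v w]) ->
  \sum_(v : 'I_n) \sum_(w | S v w) c <= n * (4 * m + 1) * c.
Proof.
move=> HS; have -> : n * (4 * m + 1) * c = \sum_(v : 'I_n) (4 * m + 1) * c.
  by rewrite sum_nat_const card_ord mulnA.
apply: leq_sum => v _; rewrite sum_nat_const leq_mul2r; apply/orP; right.
have [kv|kv] := leqP k v.
  apply: leq_trans (card_coblock kv); apply: subset_leq_card.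
  by apply/fintype.subsetP => w; rewrite !inE => /HS/and3P[_ -> ->].
rewrite eq_card0 // => w; apply/negP => /HS/and3P[]; by rewrite leqNgt kv.
Qed.

(** Once the pair of values of v and w is chosen among the pairs in a common
    block, the permutation is prescribed at two points besides the frame. *)
Lemma sum_coblock_values (v w : 'I_n) :
  v \notin D -> w \notin D -> w != v ->
  \sum_(s in framed_perms n m_gt0) coblock n m (s v) (s w)
    <= n * (4 * m + 1) * (n - #|D| - 2)`!.
Proof.
move=> vD wD wv.
pose S (a b : 'I_n) := [&& k <= a, k <= b & coblock n m a b].
apply: (@leq_trans (\sum_(s in framed_perms n m_gt0)
    \sum_(a : 'I_n) \sum_(b | S a b) ((s v == a) && (s w == b)))).
  apply: leq_sum => s sF; case cb: (coblock n m (s v) (s w)) => //.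
  rewrite (bigD1 (s v)) //= (bigD1 (s w)) ?eqxx //=.
  by rewrite /S !(unframed_val_ge sF) // cb.
rewrite exchange_big /=; under eq_bigr do rewrite exchange_big /=.
apply: leq_trans (sum_coblock (S := S) _ _); last by [].
apply: leq_sum => a _; apply: leq_sum => b _.
pose f (i : 'I_n) := if i == v then a else if i == w then b else frame n m_gt0 i.
have cardE : #|v |: (w |: D)| = #|D| + 2.
  by rewrite !cardsU1 finset.in_setU1 negb_or vD wD eq_sym wv addnA addnC.
rewrite -subnDA -cardE; apply: leq_trans (card_perm_agree_le f _).
rewrite (_ : \sum_(s in _) _ = #|[set s in framed_perms n m_gt0
    | (s v == a) && (s w == b)]%SET|); last first.
  rewrite -sum1_card [RHS](eq_bigl (fun s => (s \in framed_perms n m_gt0) &&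
    ((s v == a) && (s w == b)))); last by move=> s; rewrite finset.in_set.
  by rewrite big_mkcondr.
apply: subset_leq_card; apply/fintype.subsetP => s.
rewrite finset.in_set => /and3P[sF /eqP sv /eqP sw].
rewrite inE; apply/forall_inP => i; rewrite !finset.in_setU1 /f.
case: eqVneq => [->|_ /=]; first by rewrite sv.
case: eqVneq => [->|_ /= iD]; first by rewrite sw.
by rewrite (framed_permsP sF).
Qed.

Lemma sum_crowded :
  \sum_(s in framed_perms n m_gt0) #|crowded m s|
    <= (n * (4 * m + 1)) ^ 2 * (n - #|D| - 2)`!.
Proof.
pose S (v w : 'I_n) :=
  [&& v \notin D, w \notin D, w != v & coblock n m v w].
apply: (@leq_trans (\sum_(s in framed_perms n m_gt0)
    \sum_(v : 'I_n) \sum_(w | S v w) coblock n m (s v) (s w))).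
  apply: leq_sum => s _; rewrite -sum1_card big_mkcond /=.
  apply: leq_sum => v _; rewrite inE; case: ifP => // /andP[vD /existsP[w]].
  move=> /and4P[wv wD cb cbs].
  by rewrite (bigD1 w) ?cbs // /S vD wD wv cb.
rewrite exchange_big /=; under eq_bigr do rewrite exchange_big /=.
rewrite -mulnn -mulnA; apply: leq_trans (sum_coblock (S := S) _ _).
  apply: leq_sum => v _; apply: leq_sum => w /and4P[vD wD wv cb].
  exact: sum_coblock_values.
by move=> v w /and4P[vD wD _ ->]; rewrite !(unframed_ge _) //.
Qed.

(** Markov's inequality: by [sum_crowded] the mean number of crowded points is
    at most 4 (4m + 1)^2, as n^2 <= 4 N (N - 1) for N = n - #|D|. *)
Lemma half_framed_uncrowded : 2 * #|D| + 2 <= n ->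
  (n - #|D|)`! <= 2 * #|[set s in framed_perms n m_gt0
    | #|crowded m s| <= 8 * (4 * m + 1) ^ 2]|.
Proof.
move=> Dn; set M := 8 * _; set F := framed_perms n m_gt0.
have cF : #|F| = (n - #|D|)`! by apply: card_perm_agree.
have := cardsID [set s | #|crowded m s| <= M] F; rewrite cF.
have -> : F :&: [set s | #|crowded m s| <= M] =
          [set s in F | #|crowded m s| <= M].
  by apply/setP => s; rewrite !inE.
set good := #|_|; set bad := #|_| => cardF.
have markov : bad * M <= \sum_(s in F) #|crowded m s|.
  rewrite -sum_nat_const big_mkcond [X in _ <= X]big_mkcond /=.
  apply: leq_sum => s _; rewrite finset.in_setD andbC.
  by case: (s \in F) => //=; rewrite inE -ltnNge; case: ltnP => // /ltnW.
have := leq_trans markov sum_crowded.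
have [N eN] : exists N, n - #|D| = N.+2 by exists (n - #|D| - 2); lia.
rewrite eN in cardF *; rewrite -[in X in _ <= X -> _]eN eN subn2 /=.
rewrite !factS in cardF *.
rewrite /M expnMn; set q := (4 * m + 1) ^ 2; set f := N`! in cardF * => le.
have q_gt0 : 0 < q by rewrite expn_gt0 addn1.
have nN : n ^ 2 <= 4 * (N.+2 * N.+1) by rewrite -mulnn; nia.
have {}le : bad * 8 <= n ^ 2 * f.
  by rewrite -(leq_pmul2r q_gt0) -mulnA (leq_trans le) // mulnAC.
have : n ^ 2 * f <= 4 * (N.+2 * N.+1) * f by rewrite leq_mul2r nN orbT.
lia.
Qed.
End Crowded.

Lemma ffact_leq_expn n d : n ^_ d <= n ^ d.
Proof.
elim: d => // d IH; rewrite ffactnSr expnSr.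
by apply: leq_mul => //; apply: leq_subr.
Qed.

(** Prescribing the frame costs at most a factor n to the power #|D|, and the
    code of [card_uncrowded_framed_le] one of n^2 to the power #|D| + M, where
    #|D| <= 2k and M = 8 (4m + 1)^2. *)
Lemma fact_le_perm_ugraphs n m : 7 <= m -> 4 <= n ->
  n`! <= 2 * #|perm_ugraphs n| *
    n ^ (6 * (n %/ m.+1) + 16 * (4 * m + 1) ^ 2).
Proof.
move=> m7 n4; have m_gt0 : 0 < m by lia.
have := card_framed_points n m; set d := #|_|; set k := n %/ m.+1 => dk.
have km : k * m.+1 <= n by apply: leq_divM.
have kn : k * 8 <= n by apply: leq_trans km; rewrite leq_mul2l; lia.
have dn : 2 * d + 2 <= n by lia.
set M := 8 * (4 * m + 1) ^ 2.
have half := half_framed_uncrowded m_gt0 dn.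
have count := @card_uncrowded_framed_le n m m_gt0 M (d + M) ltac:(lia) (leqnn _).
have dn' : d <= n by lia.
rewrite -(ffact_fact dn').
apply: (@leq_trans (n ^ d * (2 * (#|perm_ugraphs n| * (n * n) ^ (d + M))))).
  apply: leq_mul; first exact: ffact_leq_expn.
  by apply: leq_trans half _; rewrite leq_mul2l.
rewrite mulnn -expnM mulnCA (mulnCA (n ^ d)) -expnD mulnA leq_mul2l.
rewrite leq_exp2l; last by lia.
apply/orP; right; rewrite /M; move: ((4 * m + 1) ^ 2) => q; lia.
Qed.

Section Growth.
Local Open Scope classical_set_scope.
Local Open Scope ring_scope.
Variable R : realType.

(** In [fact_le_perm_ugraphs] take m close to 18 L / c, where L = ln n.  The
    exponent is then of order n / m + m^2, and its product with L is below c n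
    for large n: the constant 18 leaves a third of c n for each of 6 k L, the
    term in m^2 L, which is only of order L^3, and the factor 2. *)
Lemma fact_le_expR_perm_ugraphs (c : R) : 0 < c ->
  \forall n \near \oo,
    (n`!)%:R <= #|perm_ugraphs n|%:R * expR (c * n%:R) :> R.
Proof.
move=> c_gt0; pose A : R := (400 * 324 * 72) / c ^+ 3 + 3 / c + 7 * c + 3.
have c3 : 0 < (400 * 324 * 72) / c ^+ 3 by rewrite divr_gt0 ?exprn_gt0.
have c1 : 0 < 3 / c by rewrite divr_gt0.
near=> n.
have An : expR A <= n%:R :> R by near: n; apply: nbhs_infty_ger.
have n_gt0 : 0 < n%:R :> R by apply: lt_le_trans An; rewrite expR_gt0.
set L : R := ln n%:R.
have expL : expR L = n%:R by rewrite /L lnK.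
have AL : A <= L by rewrite -ler_expR expL.
have L_gt0 : 0 < L by apply: lt_le_trans AL; rewrite /A; lra.
have nL4 : L ^+ 4 / 24 <= n%:R.
  have := expR_ge1Dxn 3 (ltW L_gt0); rewrite expL => /(le_trans _); apply.
  by rewrite (_ : 4`!%:R = 24 :> R) // lerDr.
have nL1 : 1 + L <= n%:R by rewrite -expL expR_ge1Dx.
have n4 : (4 <= n)%N.
  rewrite -(ler_nat R); apply: le_trans nL1; move: AL; rewrite /A; lra.
pose m := Num.truncn (18 * L / c).
have x_ge0 : 0 <= 18 * L / c by rewrite divr_ge0 // ?ltW // mulr_gt0.
have /andP[m_le m_gt] := truncn_itv x_ge0; rewrite -/m in m_le m_gt.
have m7 : (7 <= m)%N.
  rewrite -ltnS -(ltr_nat R); apply: le_lt_trans m_gt.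
  rewrite ler_pdivlMr //; move: AL; rewrite /A; lra.
(* The exponent is 6 k + 16 (4 m + 1)^2 and its base is n = exp L. *)
have := fact_le_perm_ugraphs m7 n4; set k := (n %/ _)%N; set e := (_ + _)%N.
rewrite -(ler_nat R) => /le_trans; apply.
rewrite !natrM natrX mulrAC mulrC ler_wpM2l //.
have -> : (n%:R ^+ e : R) = expR (e%:R * L).
  by rewrite -expL -expRM_natl.
apply: (@le_trans _ _ (expR (1 + e%:R * L))).
  by rewrite expRD ler_wpM2r ?expR_ge0 //; have := expR_ge1Dx (1 : R); lra.
rewrite ler_expR.
have kn : (k%:R * (18 * L) <= c * n%:R).
  rewrite [c * _]mulrC -ler_pdivrMr // -mulrA.
  apply: (@le_trans _ _ (k%:R * m.+1%:R)).
    by rewrite ler_wpM2l // ltW.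
  by rewrite -natrM ler_nat leq_divM.
have mb : (4 * m%:R + 1) ^+ 2 <= (5 * (18 * L / c)) ^+ 2.
  have m1 : 1 <= m%:R :> R by rewrite ler1n; apply: leq_trans m7.
  rewrite ler_pXn2r ?nnegrE //; lra.
have eE : e%:R = 6 * k%:R + 16 * (4 * m%:R + 1) ^+ 2 :> R.
  by rewrite /e natrD natrM [X in _ + X]natrM natrX natrD natrM.
have cubic : 16 * (5 * (18 * L / c)) ^+ 2 * L <= c * n%:R / 3.
  have -> : 16 * (5 * (18 * L / c)) ^+ 2 * L = (400 * 324) * L ^+ 3 / c ^+ 2.
    by field; rewrite gt_eqF.
  apply: (@le_trans _ _ (c * (L ^+ 4 / 24) / 3)); last first.
    by rewrite ler_pM2r // ler_pM2l.
  have -> : c * (L ^+ 4 / 24) / 3 = (L ^+ 3 / c ^+ 2) * (c ^+ 3 * L / 72).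
    by field; rewrite gt_eqF.
  rewrite -mulrA [X in X <= _]mulrC ler_wpM2l //.
    by rewrite divr_ge0 ?exprn_ge0 // ltW.
  have : (400 * 324 * 72) / c ^+ 3 <= L by move: AL; rewrite /A; lra.
  rewrite ler_pdivrMr ?exprn_gt0 // [L * _]mulrC; lra.
have cn3 : 1 <= c * n%:R / 3.
  have : 3 / c <= n%:R by move: AL; rewrite /A; lra.
  rewrite ler_pdivrMr // [_ * c]mulrC; lra.
have : 16 * (4 * m%:R + 1) ^+ 2 * L <= 16 * (5 * (18 * L / c)) ^+ 2 * L.
  by rewrite ler_pM2r // ler_pM2l.
rewrite eE mulrDl; lra.
Unshelve. all: by end_near.
Qed.
End Growth.

(** * Independence of decreasing patterns on disjoint sets *)

Definition decreasing_on n (s : 'S_n) (A : {set 'I_n}) : bool :=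
  [forall i in A, forall j in A, (i < j) ==> (s j < s i)].

Lemma decreasing_onP n (s : 'S_n) (A : {set 'I_n}) :
  reflect {in A &, forall i j : 'I_n, i < j -> s j < s i} (decreasing_on s A).
Proof.
apply: (iffP forall_inP) => [H i j iA jA|H i iA].
  by move/(_ i iA)/forall_inP/(_ j jA)/implyP: H.
by apply/forall_inP => j jA; apply/implyP; apply: H.
Qed.

Lemma cliques_inv_graph n k (s : 'S_n) :
  cliques k (inv_graph s) =
    [set A : {set 'I_n} | (#|A| == k) && decreasing_on s A]%SET.
Proof.
apply/setP => A; rewrite !inE; congr (_ && _).
apply/forall_inP/decreasing_onP => [H i j iA jA ij|H i iA].
  have /forall_inP/(_ j jA)/implyP := H i iA.
  rewrite /adj inE /= inv_adj_lt //; apply.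
  by apply: contraTneq ij => ->; rewrite ltnn.
apply/forall_inP => j jA; apply/implyP => ne; rewrite /adj inE /=.
case: (ltngtP i j) => [lt|lt|/val_inj e]; last by rewrite e eqxx in ne.
  by rewrite inv_adj_lt // H.
by rewrite inv_adj_sym inv_adj_lt // H.
Qed.

(** Minimise the sum of i * s(t(i)) over rearrangements t of A: by the
    rearrangement inequality, exchanging an increasing pair would make the sum
    smaller. *)
Lemma exists_decreasing_rearrangement n (s : 'S_n) (A : {set 'I_n}) :
  exists2 t, perm_on A t & decreasing_on (t * s)%g A.
Proof.
pose w (t : 'S_n) := \sum_(i : 'I_n) i * (t * s)%g i.
have [t tA tmin] := @arg_minnP _ 1%g (fun t => perm_on A t) w (perm_on1 A).
exists t => //; apply/decreasing_onP => i j iA jA ij; rewrite ltnNge.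
apply/negP => le; set f := (t * s)%g in le.
have {le} lt : f i < f j.
  rewrite ltn_neqAle le andbT; apply: contraTneq ij => /val_inj/perm_inj ->.
  by rewrite ltnn.
have ne : j != i by apply: contraTneq ij => ->; rewrite ltnn.
have t'A : perm_on A (tperm i j * t)%g.
  apply: perm_onM => //; apply/fintype.subsetP => x; rewrite inE.
  by case: tpermP => [->|->|]; rewrite ?eqxx.
have := tmin _ t'A; rewrite /w leqNgt => /negP; apply.
have val x : ((tperm i j * t) * s)%g x = f (tperm i j x).
  by rewrite /f !permM.
under eq_bigr do rewrite val.
rewrite (bigD1 i) // (bigD1 j) //= [X in _ < X](bigD1 i) // (bigD1 j) //=.
rewrite tpermL tpermR -/f !addnA.
under eq_bigr => x /andP[xi xj] do rewrite tpermD 1?eq_sym //.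
by rewrite ltn_add2r; move: ij lt; nia.
Qed.

(** Two decreasing rearrangements differ by a permutation that is supported and
    increasing on A. *)
Lemma card_decreasing_rearrangement n (s : 'S_n) (A : {set 'I_n}) :
  #|[set t : 'S_n | perm_on A t && decreasing_on (t * s)%g A]%SET| = 1.
Proof.
have [t tA ts] := exists_decreasing_rearrangement s A.
apply/eqP/cards1P; exists t; apply/setP => u; rewrite !inE.
apply/andP/eqP => [[uA us]|->] //.
suff e : (u * t^-1 = 1)%g by rewrite -[u](mulgKV t) e mul1g.
have rA : perm_on A (u * t^-1)%g by rewrite perm_onM ?perm_onV.
apply: (increasing_perm1 rA) => i j iA jA ij.
have /decreasing_onP/(_ i j iA jA ij) := us; rewrite !permM.
set a := (t^-1)%g (u i); set b := (t^-1)%g (u j) => lt.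
have aA : a \in A by rewrite /a -permM (perm_closed _ rA).
have bA : b \in A by rewrite /b -permM (perm_closed _ rA).
case: (ltngtP a b) => // [ba|/val_inj ab].
  have /decreasing_onP/(_ b a bA aA ba) := ts; rewrite !permM /a /b !permKV.
  by rewrite ltnNge ltnW.
by move/perm_inj/perm_inj: ab => e; rewrite e ltnn in ij.
Qed.

Lemma decreasing_on_fixed n (s t : 'S_n) (A B : {set 'I_n}) :
  perm_on A t -> [disjoint A & B] -> decreasing_on (t * s)%g B = decreasing_on s B.
Proof.
move=> tA dis; have tB x : x \in B -> t x = x.
  move=> xB; apply: (out_perm tA); apply/negP => xA.
  by move: (disjointFr dis xA); rewrite xB.
by apply/decreasing_onP/decreasing_onP => H i j iB jB ij;
  have := H i j iB jB ij; rewrite !permM !tB.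
Qed.

Section Concentration.
Local Open Scope ring_scope.
Variable R : realType.

(** Average over the rearrangements t of A: Phi does not change, and exactly one
    of the #|A|! rearrangements of s is decreasing on A. *)
Lemma sum_decreasing_indep n (A : {set 'I_n}) (Phi : 'S_n -> R) :
  (forall t s, perm_on A t -> Phi (t * s)%g = Phi s) ->
  \sum_s Phi s * (decreasing_on s A)%:R = (\sum_s Phi s) / ((#|A|)`!)%:R.
Proof.
move=> inv; apply: (canRL (mulfK _)); first by rewrite pnatr_eq0 -lt0n fact_gt0.
rewrite -card_perm mulr_natr -sumr_const.
rewrite (eq_bigr (fun t => \sum_s Phi s * (decreasing_on (t * s)%g A)%:R)).
  rewrite exchange_big /=; apply: eq_bigr => s _; rewrite -mulr_sumr.
  rewrite -[RHS]mulr1; congr (_ * _).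
  pose S := [set t : 'S_n | perm_on A t && decreasing_on (t * s)%g A]%SET.
  transitivity (#|S|%:R : R); last by rewrite card_decreasing_rearrangement.
  rewrite -sum1_card natr_sum.
  rewrite [RHS](eq_bigl (fun t => (t \in perm_on A) && decreasing_on (t * s)%g A)).
    by rewrite big_mkcondr; apply: eq_bigr => t _; case: decreasing_on.
  by move=> t; rewrite inE.
move=> t tA; rewrite (reindex_inj (mulgI t)) /=.
by apply: eq_bigr => s _; rewrite inv.
Qed.

(** The moment generating function of the number of sets of the family on which
    s is decreasing, at exp t = 1 + z, is that of a binomial variable with
    parameters the size of the family and 1/k!. *)
Lemma sum_prod_decreasing n k (z : R) (As : seq {set 'I_n}) :
  pairwise (fun A B : {set 'I_n} => [disjoint A & B]) As ->
  all (fun A : {set 'I_n} => #|A| == k) As ->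
  \sum_(s : 'S_n) \prod_(A <- As) (1 + z * (decreasing_on s A)%:R) =
    (n`!)%:R * (1 + z / (k`!)%:R) ^+ size As.
Proof.
elim: As => [_ _|A As IH].
  rewrite expr0 mulr1; under eq_bigr do rewrite big_nil.
  by rewrite sumr_const card_Sn.
rewrite pairwise_cons /= => /andP[dis pw] /andP[/eqP cA cAs].
pose Phi (s : 'S_n) : R := \prod_(B <- As) (1 + z * (decreasing_on s B)%:R).
have inv t s : perm_on A t -> Phi (t * s)%g = Phi s.
  move=> tA; apply: eq_big_seq => B BAs.
  by rewrite (decreasing_on_fixed _ tA) //; apply: (allP dis).
rewrite (eq_bigr (fun s => Phi s + z * (Phi s * (decreasing_on s A)%:R))).
  rewrite big_split -mulr_sumr /= (sum_decreasing_indep inv) cA IH //.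
  by rewrite exprS; ring.
by move=> s _; rewrite big_cons -/(Phi s); ring.
Qed.
End Concentration.

(** * Clique densities as averages over blocks *)

Lemma imset_perm1 n (A : {set 'I_n}) : ((1%g : 'S_n) @: A)%SET = A.
Proof. by rewrite (eq_imset _ (@perm1 _)) imset_id. Qed.

Lemma imset_permM n (p q : 'S_n) (A : {set 'I_n}) :
  ((p * q)%g @: A = q @: (p @: A))%SET.
Proof. by rewrite -imset_comp; apply: eq_imset => x; rewrite /= permM. Qed.

(** Induction on the size of A :\: B: transpose a point of A outside B with a
    point of B outside A. *)
Lemma exists_perm_imset n (A B : {set 'I_n}) :
  #|A| = #|B| -> exists p : 'S_n, (p @: A)%SET = B.
Proof.
have [m] := ubnP #|A :\: B|; elim: m A => // m IH A; rewrite ltnS => leAB eqAB.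
case: (set_0Vmem (A :\: B)) => [/eqP|[a aAB]].
  rewrite finset.setD_eq0 => sAB; exists 1%g.
  rewrite imset_perm1.
  by apply/eqP; rewrite eqEcard sAB eqAB leqnn.
have [b bBA] : exists b, b \in B :\: A.
  apply/set0Pn; rewrite -card_gt0 cardsD finset.setIC -eqAB -cardsD card_gt0.
  by apply/set0Pn; exists a.
have aA := aAB; have bA := bBA; rewrite !finset.in_setD in aA bA.
have {}aA := andP aA; have {}bA := andP bA.
pose t := tperm a b; have sub : (t @: A)%SET :\: B \subset (A :\: B) :\ a.
  apply/fintype.subsetP => x; rewrite finset.in_setD => /andP[xB /imsetP[y yA e]].
  rewrite finset.in_setD1 finset.in_setD xB /=.
  move: e; rewrite /t; case: tpermP => [_|e|/eqP ya _] ex.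
  - by move: xB; rewrite ex bA.2.
  - by move: bA.1; rewrite -e yA.
  - by rewrite ex ya yA.
have lt : #|(t @: A)%SET :\: B| < m.
  apply: leq_ltn_trans (subset_leq_card sub) _; apply: leq_trans leAB.
  by rewrite [X in _ < X](cardsD1 a) aAB.
have cB : #|(t @: A)%SET| = #|B| by rewrite card_imset //; apply: perm_inj.
have [p <-] := IH _ lt cB; exists (t * p)%g.
by rewrite imset_permM.
Qed.

Definition block n k b : {set 'I_n} := [set i : 'I_n | i %/ k == b]%SET.

Lemma card_block n k b : 0 < k -> b < n %/ k -> #|block n k b| = k.
Proof.
move=> k_gt0 bn; have bk : b * k + k <= n.
  by have := leq_divM n k; have := leq_mul bn (leqnn k); rewrite mulSn; lia.
have ltn (j : 'I_k) : b * k + j < n by have := ltn_ord j; lia.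
pose h j := Ordinal (ltn j).
have -> : block n k b = (h @: [set: 'I_k]%SET)%SET.
  apply/setP => i; rewrite inE; apply/eqP/imsetP => [e|[j _ ->]].
    exists (Ordinal (ltn_pmod i k_gt0)); rewrite ?inE //.
    by apply: val_inj; rewrite /= -e -divn_eq.
  by rewrite /= divnMDl // divn_small ?addn0.
rewrite card_imset ?cardsT ?card_ord // => i j /(congr1 val)/= /addnI.
exact: val_inj.
Qed.

Definition moved_blocks n k (p : 'S_n) : seq {set 'I_n} :=
  [seq (p @: block n k b)%SET | b <- iota 0 (n %/ k)].

Lemma moved_blocks_disjoint n k (p : 'S_n) :
  pairwise (fun A B : {set 'I_n} => [disjoint A & B]) (moved_blocks k p).
Proof.
rewrite pairwise_map; have := iota_uniq 0 (n %/ k); rewrite uniq_pairwise.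
apply: sub_pairwise => b c /= bc.
rewrite finset.disjoints_subset; apply/fintype.subsetP => _ /imsetP[i iB ->].
rewrite finset.in_setC (mem_imset _ _ (@perm_inj _ p)); move: iB; rewrite !inE.
by move/eqP => ->.
Qed.

Lemma moved_blocks_card n k (p : 'S_n) : 0 < k ->
  all (fun A : {set 'I_n} => #|A| == k) (moved_blocks k p).
Proof.
move=> k_gt0; apply/allP => A /mapP[b]; rewrite mem_iota => /andP[_ bn] ->.
by rewrite card_imset ?card_block //; apply: perm_inj.
Qed.

Section Hoeffding.
Local Open Scope ring_scope.
Variable R : realType.

(** The image of B under a uniform permutation is a uniform set of the same
    cardinality: composing with a permutation taking A to B identifies the
    permutations taking B to A with those preserving B. *)
Lemma sum_perm_imset n (B : {set 'I_n}) (F : {set 'I_n} -> R) :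
  (\sum_(p : 'S_n) F (p @: B)%SET) / (n`!)%:R =
  (\sum_(A : {set 'I_n} | #|A| == #|B|) F A) / ('C(n, #|B|))%:R.
Proof.
pose c (A : {set 'I_n}) := #|[set p : 'S_n | (p @: B)%SET == A]%SET|.
have cE (A : {set 'I_n}) : #|A| == #|B| -> c A = c B.
  move=> /eqP AB; have [q qA] := exists_perm_imset AB.
  rewrite /c -(card_imset _ (mulIg q)); apply: eq_card => r.
  apply/imsetP/idP => [[p]|].
    by rewrite !inE => /eqP pB ->; rewrite imset_permM pB qA.
  rewrite inE => /eqP rB; exists (r * q^-1)%g; rewrite ?mulgKV // inE.
  by rewrite imset_permM rB -[in X in X == _]qA -imset_permM mulgV imset_perm1.
have sumE (H : {set 'I_n} -> R) : \sum_(p : 'S_n) H (p @: B)%SET =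
    (c B)%:R * \sum_(A : {set 'I_n} | #|A| == #|B|) H A.
  rewrite (partition_big (fun p : 'S_n => (p @: B)%SET)
    (fun A : {set 'I_n} => #|A| == #|B|)) /=; last first.
    by move=> p _; rewrite card_imset //; apply: perm_inj.
  rewrite mulr_sumr; apply: eq_bigr => A AB.
  rewrite (eq_bigr (fun=> H A)); last by move=> p /eqP ->.
  rewrite sumr_const -[LHS]mulr_natl; congr (_%:R * _).
  by rewrite -(cE _ AB) /c; apply: eq_card => p; rewrite !inE.
have Bn : (#|B| <= n)%N by rewrite -[X in (_ <= X)%N]card_ord max_card.
have := sumE (fun=> 1); rewrite !sumr_const card_Sn.
have -> : #|[pred A : {set 'I_n} | #|A| == #|B|]| = 'C(n, #|B|).
  have := card_draws 'I_n #|B|; rewrite card_ord => <-.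
  by apply: eq_card => A; rewrite !inE.
move=> cC; rewrite sumE cC.
have C0 : 'C(n, #|B|)%:R != 0 :> R by rewrite pnatr_eq0 -lt0n bin_gt0.
have c0 : (c B)%:R != 0 :> R.
  by apply: contra_eq_neq cC => ->; rewrite mul0r pnatr_eq0 -lt0n fact_gt0.
by field; rewrite C0 c0.
Qed.
End Hoeffding.

(** * Exponential concentration of clique densities *)

Section Tail.
Local Open Scope ring_scope.
Variable R : realType.

Definition clique_density n k (s : 'S_n) : R :=
  #|cliques k (inv_graph s)|%:R / ('C(n, k))%:R.

Lemma clique_density_blocks n k (s : 'S_n) : (0 < k)%N ->
  (\sum_(p : 'S_n) \sum_(A <- moved_blocks k p) (decreasing_on s A)%:R) / (n`!)%:R
    = (n %/ k)%:R * clique_density k s.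
Proof.
move=> k_gt0; under eq_bigr do rewrite big_map.
rewrite exchange_big /= mulr_suml.
have cardE : #|cliques k (inv_graph s)|%:R =
    \sum_(A : {set 'I_n} | #|A| == k) (decreasing_on s A)%:R :> R.
  rewrite cliques_inv_graph -sum1_card natr_sum.
  rewrite [LHS](eq_bigl (fun A : {set 'I_n} => (#|A| == k) && decreasing_on s A)).
    by rewrite big_mkcondr; apply: eq_bigr => A _; case: decreasing_on.
  by move=> A; rewrite inE.
rewrite (eq_big_seq (fun=> clique_density k s)) => [|b].
  by rewrite big_const_seq count_predT size_iota iter_addr_0 mulr_natl.
rewrite mem_iota => /andP[_ bn].
rewrite (sum_perm_imset _ (fun A => (decreasing_on s A)%:R)) card_block //.
by rewrite /clique_density cardE.
Qed.

(** Jensen's inequality for the uniform measure: sum the tangent inequality of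
    exp at the mean. *)
Lemma expR_average (I : finType) (x : I -> R) : (0 < #|I|)%N ->
  expR ((\sum_i x i) / #|I|%:R) <= (\sum_i expR (x i)) / #|I|%:R.
Proof.
rewrite -(ltr_nat R) => I_gt0; set mu := _ / _.
rewrite ler_pdivlMr //.
have -> : expR mu * #|I|%:R = \sum_i expR mu * (1 + (x i - mu)).
  rewrite -mulr_sumr big_split /= sumrB !sumr_const -[mu *+ _]mulr_natr.
  by rewrite /mu divfK ?gt_eqF // subrr addr0.
apply: ler_sum => i _; rewrite -[x i in X in _ <= X](subrKC mu) expRD.
by rewrite ler_pM2l ?expR_gt0 // expR_ge1Dx.
Qed.

Lemma mgf_clique_density n k (t : R) : (0 < k)%N ->
  \sum_(s : 'S_n) expR (t * ((n %/ k)%:R * clique_density k s)) <=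
    (n`!)%:R * (1 + (expR t - 1) / (k`!)%:R) ^+ (n %/ k).
Proof.
move=> k_gt0; pose z := expR t - 1.
have f0 : (n`!)%:R != 0 :> R by rewrite pnatr_eq0 -lt0n fact_gt0.
have step (s : 'S_n) : expR (t * ((n %/ k)%:R * clique_density k s)) <=
    (\sum_(p : 'S_n) \prod_(A <- moved_blocks k p)
       (1 + z * (decreasing_on s A)%:R)) / (n`!)%:R.
  rewrite -clique_density_blocks // mulrA mulr_sumr -card_Sn.
  apply: le_trans (expR_average _ _) _.
    by rewrite card_Sn fact_gt0.
  rewrite ler_pM2r ?invr_gt0 ?ltr0n ?card_Sn ?fact_gt0 //.
  apply: ler_sum => p _; rewrite mulr_sumr expR_sum.
  apply: ler_prod => A _; rewrite expR_ge0 /=.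
  case: decreasing_on; rewrite /= ?mulr1 ?mulr0 ?addr0 ?expR0 //.
  by rewrite /z subrKC.
apply: le_trans (ler_sum _ (fun s _ => step s)) _.
rewrite -mulr_suml exchange_big /=.
rewrite (eq_bigr (fun=> (n`!)%:R * (1 + z / (k`!)%:R) ^+ (n %/ k))).
  by rewrite sumr_const card_Sn -[_ *+ _]mulr_natr mulfK.
move=> p _; rewrite (sum_prod_decreasing z (moved_blocks_disjoint k p)
  (moved_blocks_card p k_gt0)).
by rewrite size_map size_iota.
Qed.

(** From 1 - t <= exp (- t), as (1 - t) (1 + t + 2 t^2) = 1 + t^2 (1 - 2 t). *)
Lemma expR_le_quadratic (t : R) : t <= 1 / 2 -> expR t <= 1 + t + 2 * t ^+ 2.
Proof.
move=> t2; have h : 1 - t <= expR (- t) by exact: expR_ge1Dx.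
have t1 : 0 < 1 - t by lra.
rewrite -[expR t]opprK -[t in expR t]opprK expRN opprK.
apply: (@le_trans _ _ (1 - t)^-1).
  by rewrite lef_pV2 ?posrE ?expR_gt0.
rewrite -div1r ler_pdivrMr //.
have : 0 <= t ^+ 2 * (1 - 2 * t) by rewrite mulr_ge0 ?sqr_ge0 //; lra.
by rewrite -subr_ge0 => h2; rewrite -subr_ge0; apply: le_trans h2 _;
  rewrite le_eqVlt; apply/orP; left; apply/eqP; ring.
Qed.

(** Markov's inequality for exp (t N (X - p)), with N = n %/ k, X the clique
    density and p = 1/k!, whose mean is at most exp (2 t^2 N). *)
Lemma clique_density_chernoff n k (t a : R) : (0 < k)%N -> `|t| <= 1 / 2 ->
  #|[set s : 'S_n | a <= t * (clique_density k s - (k`!)%:R^-1)]%SET|%:R <=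
    (n`!)%:R * expR ((2 * t ^+ 2 - a) * (n %/ k)%:R) :> R.
Proof.
move=> k_gt0 t2; set S := [set s | _]%SET; set N := (n %/ k)%:R.
set p := (k`!)%:R^-1 : R.
have p01 : 0 <= p <= 1.
  by rewrite invr_ge0 ler0n invf_le1 ?ltr0n ?ler1n fact_gt0.
have N_ge0 : 0 <= N :> R by rewrite ler0n.
have tle : t <= 1 / 2 by apply: le_trans t2; apply: ler_norm.
have : #|S|%:R * expR ((a + t * p) * N) <=
    \sum_(s : 'S_n) expR (t * (N * clique_density k s)) :> R.
  rewrite -sum1_card natr_sum mulr_suml.
  apply: (@le_trans _ _ (\sum_(s in S) expR (t * (N * clique_density k s)))).
    apply: ler_sum => s; rewrite inE mul1r ler_expR -/p => sS.
    rewrite mulrCA [X in _ <= X]mulrC ler_wpM2r //; lra.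
  rewrite [X in _ <= X](bigID [in S]) /= lerDl.
  by apply: sumr_ge0 => s _; rewrite expR_ge0.
move=> /le_trans/(_ (mgf_clique_density n t k_gt0)).
have base : 1 + (expR t - 1) * p <= expR ((t + 2 * t ^+ 2) * p).
  apply: le_trans (expR_ge1Dx _); rewrite lerD2l ler_wpM2r //; first lra.
  by have := expR_le_quadratic tle; lra.
have base0 : 0 <= 1 + (expR t - 1) * p.
  have := expR_ge0 t; nra.
have powle : (1 + (expR t - 1) * p) ^+ (n %/ k) <=
    expR ((t + 2 * t ^+ 2) * p) ^+ (n %/ k).
  by apply: lerXn2r; rewrite ?nnegrE ?expR_ge0.
move=> /le_trans/(_ (ler_wpM2l (ler0n R _) powle)).
rewrite -expRM_natl -/N => H.
rewrite -(ler_pM2r (expR_gt0 ((a + t * p) * N))).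
apply: le_trans H _; rewrite -mulrA ler_wpM2l // -expRD ler_expR.
rewrite mulrC -mulrDl ler_wpM2r //.
have : 0 <= t ^+ 2 * (1 - p) by rewrite mulr_ge0 ?sqr_ge0 //; lra.
lra.
Qed.

(** The choice t = e / 4 in the upper tail and t = - e / 4 in the lower tail
    minimises 2 t^2 - e |t|. *)
Lemma clique_density_tail n k (e : R) : (0 < k)%N -> 0 < e <= 1 ->
  #|[set s : 'S_n | e <= `|clique_density k s - (k`!)%:R^-1|]%SET|%:R <=
    2 * (n`!)%:R * expR (- (e ^+ 2 / 8 * (n %/ k)%:R)) :> R.
Proof.
move=> k_gt0 /andP[e_gt0 e_le1].
have e4 : `|e / 4| <= 1 / 2 by rewrite gtr0_norm; lra.
have up := clique_density_chernoff n (e ^+ 2 / 4) k_gt0 e4.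
have lo := @clique_density_chernoff n k (- (e / 4)) (e ^+ 2 / 4) k_gt0.
rewrite normrN in lo; have {}lo := lo e4.
have E : 2 * (e / 4) ^+ 2 - e ^+ 2 / 4 = - (e ^+ 2 / 8) by field.
rewrite sqrrN in lo; rewrite E mulNr in up lo.
rewrite -mulrA mulr2n mulrDl mul1r.
apply: le_trans (lerD up lo); rewrite -natrD ler_nat.
apply: leq_trans (leq_card_setU _ _); apply: subset_leq_card.
apply/fintype.subsetP => s; rewrite !inE => H.
set x := clique_density k s - _ in H *.
case: (lerP 0 x) => x0; [rewrite ger0_norm // in H|rewrite ltr0_norm // in H].
  by apply/orP; left; nra.
by apply/orP; right; nra.
Qed.
End Tail.

(** * Edges and triangles as cliques *)

Section SmallCliques.
Variables (n : nat) (g : sgraph n).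

Lemma adj_irrefl i : adj g i i = false.
Proof.
by rewrite /adj; case: g => A /= H; have /andP[/forallP/(_ i)/negPf] := H.
Qed.

Lemma adj_sym i j : adj g i j = adj g j i.
Proof.
rewrite /adj; case: g => A /= H.
by have /andP[_ /forallP/(_ i)/forallP/(_ j)/eqP] := H.
Qed.

Lemma adj_neq i j : adj g i j -> i != j.
Proof. by apply: contraTneq => ->; rewrite adj_irrefl. Qed.

Lemma edges_cliques : edges g = cliques 2 g.
Proof.
apply/setP => A; rewrite !inE; apply/existsP/andP => [[i /existsP[j]]|].
  move=> /andP[ij /eqP ->]; rewrite cards2 adj_neq //; split => //.
  apply/forall_inP => x; rewrite !inE => /orP[]/eqP->;
    apply/forall_inP => y; rewrite !inE => /orP[]/eqP->;
    by rewrite ?eqxx ?ij ?implybT // adj_sym ij implybT.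
move=> [/cards2P[i [j [ij ->]]] /forall_inP H]; exists i; apply/existsP; exists j.
have /forall_inP/(_ j (finset.set22 i j))/implyP/(_ ij) adj_ij :=
  H i (finset.set21 i j).
by rewrite adj_ij eqxx.
Qed.

Lemma triangles_cliques : triangles g = cliques 3 g.
Proof.
apply/setP => A; rewrite !inE.
apply/existsP/andP => [[i /existsP[j /existsP[l]]]|].
  move=> /and4P[ij jl il /eqP ->]; split.
    by rewrite finset.setUC cardsU1 !inE cards2 negb_or !(eq_sym l) !adj_neq.
  apply/forall_inP => x; rewrite !inE -orbA => /or3P[]/eqP->;
    apply/forall_inP => y; rewrite !inE -orbA => /or3P[]/eqP->;
    rewrite ?eqxx ?ij ?jl ?il ?implybT //;
    by rewrite adj_sym ?ij ?jl ?il implybT.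
move=> [cA /forall_inP H].
have [i iA] : exists i, i \in A by apply/set0Pn; rewrite -card_gt0 (eqP cA).
move: cA; rewrite (cardsD1 i) iA add1n eqSS => /cards2P[j [l [jl Ai]]].
have := finset.setD1K iA; rewrite Ai finset.setUA => eA; subst.
have : i \notin [set j; l]%SET by rewrite -Ai !inE eqxx.
rewrite !inE negb_or => /andP[ij il].
have adjP x y : x \in [set i; j; l]%SET -> y \in [set i; j; l]%SET ->
    x != y -> adj g x y.
  by move=> xA yA xy; have /forall_inP/(_ y yA)/implyP := H x xA; apply.
exists i; apply/existsP; exists j; apply/existsP; exists l.
by rewrite eqxx andbT !adjP // !inE eqxx ?orbT.
Qed.
End SmallCliques.

(** * Almost sure convergence *)

Section AlmostSure.
Local Open Scope classical_set_scope.
Local Open Scope ring_scope.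
Variables (R : realType) (d : measure_display) (T : measurableType d).
Variable (P : probability T R).

Lemma uniform_on_le (X : finType) (A B : {set X}) (Y : T -> X) :
  uniform_on P A Y ->
  (P (Y @^-1` [set x | x \in B]) <= (#|A :&: B|%SET%:R / #|A|%:R)%:E)%E.
Proof.
move=> [mY PY].
have le (s : seq X) : (P (Y @^-1` [set x | x \in s]) <=
    (\sum_(x <- s) (if x \in A then #|A|%:R^-1 else 0))%:E)%E.
  elim: s => [|x s IH].
    rewrite big_nil (_ : _ @^-1` _ = set0) ?measure0 //.
    by apply/seteqP; split => w.
  have -> : Y @^-1` [set y | y \in x :: s] =
      Y @^-1` [set x] `|` Y @^-1` [set y | y \in s].
    apply/seteqP; split => w /=; rewrite inE.
      by case/orP => [/eqP|]; [left|right].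
    by case=> [->|->]; rewrite ?eqxx ?orbT.
  rewrite big_cons EFinD; apply: le_trans (measureU2 _ (mY _) (mY _)) _.
  by apply: leeD => //; rewrite -PY.
have := le (enum B); have -> : [set x | x \in enum B] = [set x | x \in B].
  by apply/seteqP; split => x /=; rewrite mem_enum.
move=> /le_trans; apply; rewrite lee_fin big_enum /= -big_mkcondr /=.
rewrite sumr_const -[X in X <= _]mulr_natl ler_wpM2r ?invr_ge0 //.
by rewrite ler_nat; apply/eq_leq/eq_card => x; rewrite !inE andbC.
Qed.

Lemma borel_cantelli_geometric (F : nat -> set T) (K q : R) :
  (forall n, measurable (F n)) -> 0 < q < 1 ->
  (\forall n \near \oo, (P (F n) <= (K * q ^+ n)%:E)%E) ->
  {ae P, forall w : T, \forall n \near \oo, ~ F n w}.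
Proof.
move=> mF /andP[q0 q1] [N _ HN].
(* The bound holds from N on only; emptying the earlier events makes it hold
   for every n. *)
pose E n := if (N <= n)%N then F n else set0.
have mE n : measurable (E n) by rewrite /E; case: ifP.
have sumE : (\sum_(n <oo) P (E n) < +oo)%E.
  pose g : nat -> R := geometric `|K| q.
  have := @lee_nneseries R (fun n => P (E n)) (fun n => (g n)%:E) xpredT 0%N.
  move=> /(_ (fun _ _ _ => measure_ge0 _ _)) le.
  apply: le_lt_trans (le _) _.
    move=> n _; rewrite /E /g /=; case: ifP => [Nn|_].
      apply: le_trans (HN n Nn) _; rewrite lee_fin ler_wpM2r ?ler_norm //.
      by rewrite exprn_ge0 // ltW.
    by rewrite measure0 lee_fin mulr_ge0 // exprn_ge0 // ltW.
  rewrite (_ : (fun n => _) = EFin \o series g); last first.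
    by apply/funext => n /=; rewrite sumEFin.
  rewrite EFin_lim ?ltry //; apply: is_cvg_geometric_series.
  by rewrite ger0_norm // ltW.
have E0 := lim_sup_set_cvg0 mE sumE.
exists (lim_sup_set E); split => //.
  apply: bigcap_measurable => // n _; exact: bigcup_measurable.
move=> w /= nw; rewrite /lim_sup_set => M _.
apply: contrapT => nE; apply: nw; exists (maxn M N) => // n /=.
rewrite geq_max => /andP[Mn Nn] Fn; apply: nE; exists n => //.
by rewrite /E Nn.
Qed.

Variable (G : forall n : nat, T -> ugraph n).
Hypothesis (hG : forall n : nat, (1 <= n)%N -> uniform_on P (perm_ugraphs n) (G n)).

Definition deviant n k (e : R) : {set ugraph n} :=
  [set x : ugraph n |
    e <= `|(num_cliques k x)%:R / ('C(n, k))%:R - (k`!)%:R^-1|]%SET.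

(** Each deviant unlabeled permutation graph comes from a deviant permutation. *)
Lemma card_deviant_le n k (e : R) :
  (#|perm_ugraphs n :&: deviant n k e|%SET <=
    #|[set s : 'S_n | (e <= `|clique_density R k s - (k`!)%:R^-1|)%R ]%SET|)%N.
Proof.
set S := [set s | _]%SET.
apply: leq_trans (leq_imset_card (fun s => \pi_(ugraph n) (inv_graph s)) S).
apply: subset_leq_card; apply/fintype.subsetP => x.
rewrite finset.in_setI => /andP[/imsetP[s _ ->]]; rewrite inE num_cliques_pi => H.
by apply: imset_f; rewrite inE.
Qed.

(** The uniform law on graphs charges a set by at most n! / #|perm_ugraphs n|
    times its probability under a uniform permutation.  This ratio is at most
    exp (c n), where c is half of the rate e^2 / (8 k) of [clique_density_tail];
    the constant exp (e^2 / 8) makes up for rounding n / k down. *)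
Lemma deviant_prob_le k (e : R) : (0 < k)%N -> 0 < e <= 1 ->
  \forall n \near \oo, (P (G n @^-1` [set x | x \in deviant n k e]) <=
    (2 * expR (e ^+ 2 / 8) * (expR (- (e ^+ 2 / (16 * k%:R)))) ^+ n)%:E)%E.
Proof.
move=> k_gt0 e01; have /andP[e0 e1] := e01.
have k0 : 0 < k%:R :> R by rewrite ltr0n.
pose c := e ^+ 2 / (16 * k%:R).
have c0 : 0 < c by rewrite divr_gt0 ?mulr_gt0 ?exprn_gt0.
near=> n.
have n1 : (1 <= n)%N by near: n; exists 1%N.
have growth : (n`!)%:R <= #|perm_ugraphs n|%:R * expR (c * n%:R).
  by near: n; apply: fact_le_expR_perm_ugraphs.
have g0 : 0 < #|perm_ugraphs n|%:R :> R.
  have : 0 < #|perm_ugraphs n|%:R * expR (c * n%:R).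
    by apply: lt_le_trans growth; rewrite ltr0n fact_gt0.
  by rewrite pmulr_lgt0 ?expR_gt0.
apply: le_trans (uniform_on_le _ (hG n1)) _; rewrite lee_fin ler_pdivrMr //.
have := card_deviant_le n k e; rewrite -(ler_nat R) => /le_trans; apply.
apply: le_trans (clique_density_tail n k_gt0 e01) _.
apply: (@le_trans _ _ (2 * (#|perm_ugraphs n|%:R * expR (c * n%:R)) *
    expR (- (e ^+ 2 / 8 * (n %/ k)%:R)))).
  by rewrite ler_wpM2r ?expR_ge0 // ler_pM2l.
rewrite -expRM_natl -/c.
have -> : 2 * (#|perm_ugraphs n|%:R * expR (c * n%:R)) *
    expR (- (e ^+ 2 / 8 * (n %/ k)%:R)) = 2 * #|perm_ugraphs n|%:R *
    expR (c * n%:R - e ^+ 2 / 8 * (n %/ k)%:R) by rewrite expRD; ring.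
have -> : 2 * expR (e ^+ 2 / 8) * expR (n%:R * - c) * #|perm_ugraphs n|%:R =
   2 * #|perm_ugraphs n|%:R * expR (e ^+ 2 / 8 + n%:R * - c) by rewrite expRD; ring.
rewrite ler_wpM2l ?mulr_ge0 // ler_expR.
have nk : n%:R <= ((n %/ k)%:R + 1) * k%:R :> R.
  by rewrite natr1 -natrM ler_nat ltnW // ltn_ceil.
have : c * 2 * n%:R <= e ^+ 2 / 8 * ((n %/ k)%:R + 1).
  apply: le_trans (ler_wpM2l _ nk) _; first by rewrite mulr_ge0 // ltW.
  rewrite le_eqVlt; apply/orP; left; apply/eqP.
  by rewrite /c; field; rewrite gt_eqF.
lra.
Unshelve. all: by end_near.
Qed.

(** Convergence is the conjunction over j of eventual (1 / (j + 1))-closeness,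
    so countably many null sets suffice.  The laws are known from n = 1 on,
    hence the shift by one. *)
Lemma ae_clique_density k : (1 <= k)%N ->
  {ae P, forall w : T,
    (fun n : nat => (num_cliques k (G n w))%:R / ('C(n, k))%:R : R) @ \oo
      --> (1 / (k`!)%:R : R)}.
Proof.
move=> k1; pose e (j : nat) : R := j.+1%:R^-1.
have e01 j : 0 < e j <= 1 by rewrite invr_gt0 ltr0n invf_le1 ?ltr0n ?ler1n.
have dev j : {ae P, forall w : T, \forall n \near \oo,
    ~ (G n.+1 @^-1` [set x | x \in deviant n.+1 k (e j)]) w}.
  have /andP[ej0 ej1] := e01 j.
  pose q := expR (- (e j ^+ 2 / (16 * k%:R))).
  apply: (@borel_cantelli_geometric _ (2 * expR (e j ^+ 2 / 8) * q) q).
  - by move=> n; apply: (hG (ltn0Sn n)).1.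
  - by rewrite expR_gt0 expR_lt1 oppr_lt0 divr_gt0 ?mulr_gt0 ?exprn_gt0 ?ltr0n.
  - have [N _ HN] := deviant_prob_le k1 (e01 j).
    exists N => // n /= Nn; rewrite -mulrA -exprS; apply: HN => /=.
    exact: leqW.
have := ae_foralln dev; apply: filterS => w H.
apply/cvgrPdist_lt => eps eps0.
have [j ej] : exists j, e j <= eps.
  exists (Num.truncn eps^-1); rewrite /e invf_ple ?posrE ?ltr0n //.
  by rewrite ltW // truncnS_gt.
have [N _ HN] := H j; exists N.+1 => // -[//|n] /= Nn.
have /negP := HN n Nn; rewrite /= inE -ltNge => lt.
by rewrite distrC div1r; apply: lt_le_trans ej.
Qed.
End AlmostSure.

Unset Implicit Arguments.

Local Open Scope classical_set_scope.
Local Open Scope ring_scope.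

Theorem mainTheorem5 (R : realType) (d : measure_display)
    (T : measurableType d) (P : probability T R)
    (G : forall n : nat, T -> ugraph n)
    (hG : forall n : nat, (1 <= n)%N -> uniform_on P (perm_ugraphs n) (G n)) :
  (forall k : nat, (1 <= k)%N ->
     {ae P, forall w : T,
        (fun n : nat => (num_cliques k (G n w))%:R / ('C(n, k))%:R : R) @ \oo
          --> (1 / (k`!)%:R : R)}) /\
  {ae P, forall w : T,
     (fun n : nat => (num_edges (G n w))%:R / ('C(n, 2))%:R : R) @ \oo
       --> (1 / 2%:R : R)} /\
  {ae P, forall w : T,
     (fun n : nat => (num_triangles (G n w))%:R / ('C(n, 3))%:R : R) @ \oo
       --> (1 / 6%:R : R)}.
Proof.
have edgesE n (x : ugraph n) : num_edges x = num_cliques 2 x.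
  by rewrite /num_edges edges_cliques.
have trianglesE n (x : ugraph n) : num_triangles x = num_cliques 3 x.
  by rewrite /num_triangles triangles_cliques.
split; first by move=> k; apply: ae_clique_density.
have ae_count k (f : forall n, ugraph n -> nat) : (1 <= k)%N ->
    (forall n x, f n x = num_cliques k x) ->
    {ae P, forall w : T, (fun n : nat => (f n (G n w))%:R / ('C(n, k))%:R : R)
      @ \oo --> (1 / (k`!)%:R : R)}.
  move=> k1 fE; apply: filterS (ae_clique_density hG k1) => w.
  rewrite (_ : (fun n => (f n (G n w))%:R / _) =
    fun n => (num_cliques k (G n w))%:R / ('C(n, k))%:R) //.
  by apply/funext => n; rewrite fE.
split; first exact: (ae_count 2 (fun n => @num_edges n)).
exact: (ae_count 3 (fun n => @num_triangles n)).
Qed.
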